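(* Let $T>0$, let $d\ge1$ be an integer, let $0<\gamma\le 1$, and let $F:[0,T]\to\mathcal{K}(\mathbb{R}^d)$ be $\gamma$-Hölder. Set $\Omega=F(0)$. For all $\omega\in\Omega$ there exists a selection $f(\omega)\in\mathbf{V}^{1/\gamma+}([0,T]\to\mathbb{R}^d)$ of $F$ (that is, $f_t(\omega)\in F(t)$ for all $t\in[0,T]$) such that $f_0(\omega)=\omega$ and such that, for all $p>1/\gamma$, $$V_p(f(\omega))\le C\,H_\gamma(F),$$ with $C$ a constant depending on $p$, $\gamma$ and $T$. Moreover, $f(\omega)$ can be chosen such that the map $f$ is measurable from $\Omega$ to its target path space.
   Context: $\mathcal{K}(\mathbb{R}^d)$ is the set of nonempty compact subsets of $\mathbb{R}^d$, with the Hausdorff distance $h$. $H_\gamma(F)=\sup_{s\ne t\in[0,T]}h(F(s),F(t))/|t-s|^\gamma$, and $F$ is $\gamma$-Hölder if $H_\gamma(F)<\infty$. For a path $x:[0,T]\to\mathbb{R}^d$ and $p\ge1$, $V_p(x)=\sup\big(\sum_{k=1}^n|x_{\sigma_k}-x_{\sigma_{k-1}}|^p\big)^{1/p}$, the supremum being over all finite sets $\sigma_0<\dots<\sigma_n$ in $[0,T]$. $\mathbf{V}^p([0,T]\to\mathbb{R}^d)$ is the set of càdlàg (right-continuous with left limits) paths $x$ with $V_p(x)<\infty$, and $\mathbf{V}^{r+}=\bigcap_{p>r}\mathbf{V}^p$. $\Omega\subseteq\mathbb{R}^d$ carries the Borel $\sigma$-algebra and path spaces carry the cylindrical $\sigma$-algebra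 (the smallest one making all evaluations $x\mapsto x_t$, $t\in[0,T]$, measurable). *)

(* Defs.v *)
From HB Require Import structures.
From mathcomp Require Import all_boot all_order all_algebra.
From mathcomp Require Import all_classical all_reals all_analysis.

Set Implicit Arguments.
Unset Strict Implicit.
Unset Printing Implicit Defensive.

Import Order.TTheory GRing.Theory Num.Theory.
Import numFieldNormedType.Exports.

Local Open Scope classical_set_scope.
Local Open Scope ring_scope.

(* R^d is 'rV[R]_d. A function on [0, T] is a total function on R of which only
   the values on `[0, T] are ever used. *)

(* The library norm on 'rV[R]_d is the sup norm; it induces the same topology
   as the Euclidean norm. *)
Definition enorm (R : realType) (d : nat) (x : 'rV[R]_d) : R :=
  Num.sqrt (\sum_(i < d) x ord0 i ^+ 2).

Definition nonempty_compacts (R : realType) (d : nat) : set (set 'rV[R]_d) :=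
  [set A | A !=set0 /\ compact A].

Definition set_dist (R : realType) (d : nat) (x : 'rV[R]_d)
    (A : set 'rV[R]_d) : \bar R :=
  ereal_inf [set (enorm (x - a))%:E | a in A].

Definition hausdorff_dist (R : realType) (d : nat)
    (A B : set 'rV[R]_d) : \bar R :=
  maxe (ereal_sup [set set_dist a B | a in A])
       (ereal_sup [set set_dist b A | b in B]).

Definition holder_coef (R : realType) (d : nat) (T gamma : R)
    (F : R -> set 'rV[R]_d) : \bar R :=
  ereal_sup [set q | exists s t : R,
    [/\ s \in `[0, T], t \in `[0, T], s != t
      & q = (hausdorff_dist (F s) (F t) * ((`|t - s| `^ gamma)^-1)%:E)%E]].

Definition p_variation (R : realType) (d : nat) (T p : R)
    (x : R -> 'rV[R]_d) : \bar R :=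
  ereal_sup [set v | exists (n : nat) (sigma : nat -> R),
    [/\ forall k, (k <= n)%N -> sigma k \in `[0, T],
        forall k, (k < n)%N -> sigma k < sigma k.+1
      & v = ((\sum_(k < n) enorm (x (sigma k.+1) - x (sigma k)) `^ p)
               `^ p^-1)%:E]].

Definition cadlag (R : realType) (d : nat) (T : R)
    (x : R -> 'rV[R]_d) : Prop :=
  (forall t : R, 0 <= t < T -> x s @[s --> t^'+] --> x t) /\
  (forall t : R, 0 < t <= T -> cvg (x s @[s --> t^'-])).

Definition Vspace (R : realType) (d : nat) (T p : R) : set (R -> 'rV[R]_d) :=
  [set x | cadlag T x /\ (p_variation T p x < +oo)%E].

Definition Vspace_plus (R : realType) (d : nat) (T r : R) :
    set (R -> 'rV[R]_d) :=
  \bigcap_(p in [set p : R | r < p]) Vspace T p.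

Definition borelRd (R : realType) (d : nat) :=
  g_sigma_algebraType (@open 'rV[R]_d).

Definition cylinders (R : realType) (d : nat) (T : R) :
    set (set (R -> 'rV[R]_d)) :=
  \bigcup_(t in `[0, T])
    preimage_set_system setT (fun x : R -> 'rV[R]_d => x t)
      (@measurable _ (borelRd R d)).

(* The cylindrical sigma-algebra of a set X of paths is the trace on X of that
   of path_space, so a map into X is measurable iff it is measurable as a map
   into path_space. *)
Definition path_space (R : realType) (d : nat) (T : R) :=
  g_sigma_algebraType (@cylinders R d T).

(* Main.v *)
Require Import Defs.
From HB Require Import structures.
From mathcomp Require Import all_boot all_order all_algebra.
From mathcomp Require Import all_classical all_reals all_analysis.
From mathcomp Require Import ring lra.

(** The selection is the limit along the branches of a dyadic tree. Put H for the
    Hoelder constant of F and attach to each dyadic time t a point of F(t) as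
    follows: the point at time 0 is omega, and a time that appears at rank n receives a
    point of F(t) close to the one already attached to its left neighbour of rank
    n - 1, at distance O(H 2^(-n gamma)). Following the dyadic times that approximate
    t from below, these points converge geometrically ([geometric_steps_limit]), and
    the limit f_t(omega) is in F(t) since F(t) is compact and F is continuous
    ([tree_selection_in]).

    Two times in the same dyadic cell of rank n share their branch up to rank n, so the
    path oscillates by O(H q^n) on each cell of rank n, where q = 2^(-gamma)
    ([tree_selection_oscillation]). Across the boundary of two cells there is no such
    control, and the path may jump there; but cells are closed on the left and open on the
    right, so it is cadlag ([cadlag_cell_oscillation]). For the p-variation, sort the
    increments of a partition by the first rank n at which the cells of their
    endpoints differ. There are at most 2^n increments of rank n, each of size
    O(H q^n), so that the sum of their p-th powers is at most a constant times
    H^p times the geometric series of ratio 2 q^p = 2^(1 - gamma p), which converges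
    when p > 1/gamma ([p_variation_cell_oscillation]). The constants do not involve
    the dimension, and the path does not depend on p.

    For measurability in omega, the close points are chosen by a Borel function, with
    values in a finite net of F(t) when H > 0 ([measurable_near_projection]). For
    fixed t the approximations of f_t are then finite compositions of Borel maps and
    converge uniformly on F(0) ([measurable_uniform_limit]); evaluations generate the
    sigma-algebra of the path space ([measurable_path_map]). *)

Set Implicit Arguments.
Unset Strict Implicit.
Unset Printing Implicit Defensive.

Import Order.TTheory GRing.Theory Num.Theory.
Import numFieldNormedType.Exports.

Local Open Scope classical_set_scope.
Local Open Scope ring_scope.

(** * The Euclidean norm on row vectors *)

Lemma enorm_ge0 (R : realType) d (x : 'rV[R]_d) : 0 <= enorm x.
Proof. exact: sqrtr_ge0. Qed.

Lemma enorm_sqr (R : realType) d (x : 'rV[R]_d) :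
  enorm x ^+ 2 = \sum_(i < d) x ord0 i ^+ 2.
Proof. by rewrite sqr_sqrtr// sumr_ge0// => i _; exact: sqr_ge0. Qed.

Lemma enorm0 (R : realType) d : enorm (0 : 'rV[R]_d) = 0.
Proof.
by rewrite /enorm big1 ?sqrtr0// => i _; rewrite mxE expr0n.
Qed.

Lemma enormN (R : realType) d (x : 'rV[R]_d) : enorm (- x) = enorm x.
Proof. by congr Num.sqrt; apply: eq_bigr => i _; rewrite mxE sqrrN. Qed.

Lemma enormB (R : realType) d (x y : 'rV[R]_d) : enorm (x - y) = enorm (y - x).
Proof. by rewrite -enormN opprB. Qed.

(** Limits and neighbourhoods are those of the sup norm, while all estimates are
    Euclidean; this comparison transfers the estimates. *)
Lemma norm_le_enorm (R : realType) d (x : 'rV[R]_d) : `|x| <= enorm x.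
Proof.
rewrite /Num.norm/= mx_normrE; apply/bigmax_leP; split; first exact: enorm_ge0.
move=> [i j] _ /=; rewrite (ord1 i) /enorm -sqrtr_sqr ler_sqrt; last first.
  by apply: sumr_ge0 => k _; exact: sqr_ge0.
by rewrite (bigD1 j)//= lerDl; apply: sumr_ge0 => k _; exact: sqr_ge0.
Qed.

Lemma enorm_gt0 (R : realType) d (x : 'rV[R]_d) : (0 < enorm x) = (x != 0).
Proof.
rewrite lt0r enorm_ge0 andbT; congr negb; apply/eqP/eqP => [x0|->].
  by apply/eqP; rewrite -normr_le0 -x0 norm_le_enorm.
exact: enorm0.
Qed.

(** Expand the sum of the squares of [enorm y * x_i - enorm x * y_i] and divide by
    [enorm x * enorm y]. *)
Lemma cauchy_schwarz (R : realType) d (x y : 'rV[R]_d) :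
  \sum_(i < d) x ord0 i * y ord0 i <= enorm x * enorm y.
Proof.
have [->|x0] := eqVneq x 0.
  by rewrite enorm0 mul0r big1// => i _; rewrite mxE mul0r.
have [->|y0] := eqVneq y 0.
  by rewrite enorm0 mulr0 big1// => i _; rewrite mxE mulr0.
have : 0 <= \sum_(i < d) (enorm y * x ord0 i - enorm x * y ord0 i) ^+ 2.
  by apply: sumr_ge0 => i _; exact: sqr_ge0.
have -> : \sum_(i < d) (enorm y * x ord0 i - enorm x * y ord0 i) ^+ 2 =
    enorm y ^+ 2 * (\sum_(i < d) x ord0 i ^+ 2)
    + enorm x ^+ 2 * (\sum_(i < d) y ord0 i ^+ 2)
    - 2 * (enorm x * enorm y) * \sum_(i < d) x ord0 i * y ord0 i.
  rewrite !mulr_sumr -big_split -sumrB; apply: eq_bigr => i _ /=; ring.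
rewrite -!enorm_sqr => h.
have xy : 0 < enorm x * enorm y by rewrite mulr_gt0// enorm_gt0.
rewrite -(ler_pM2l xy); nra.
Qed.

Lemma enormD (R : realType) d (x y : 'rV[R]_d) :
  enorm (x + y) <= enorm x + enorm y.
Proof.
rewrite -(@ler_pXn2r _ 2)// ?nnegrE ?enorm_ge0 ?addr_ge0 ?enorm_ge0//.
rewrite enorm_sqr sqrrD !enorm_sqr.
have -> : \sum_(i < d) (x + y) ord0 i ^+ 2 = \sum_(i < d) x ord0 i ^+ 2 +
    (\sum_(i < d) x ord0 i * y ord0 i) *+ 2 + \sum_(i < d) y ord0 i ^+ 2.
  rewrite -sumrMnl -!big_split; apply: eq_bigr => i _ /=.
  by rewrite mxE; ring.
by rewrite lerD2r lerD2l lerMn2r cauchy_schwarz.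
Qed.

Lemma enorm_le_trans (R : realType) d (y x z : 'rV[R]_d) :
  enorm (x - z) <= enorm (x - y) + enorm (y - z).
Proof. by rewrite -{1}(subrK y x) -addrA enormD. Qed.

Lemma continuous_enorm (R : realType) d : continuous (@enorm R d).
Proof.
move=> x; rewrite /enorm.
apply: (@continuous_comp _ _ _ (fun x : 'rV[R]_d => \sum_(i < d) x ord0 i ^+ 2)
  Num.sqrt); last exact: sqrt_continuous.
apply: (@continuous_big R _ _ _ xpredT) => [|i _ z]; first exact: add_continuous.
apply: (@continuous_comp _ _ _ (fun x : 'rV[R]_d => x ord0 i) (fun y => y ^+ 2)).
  exact: coord_continuous.
exact: exprn_continuous.
Qed.

Lemma continuous_enormB (R : realType) d (a : 'rV[R]_d) :
  continuous (fun x : 'rV[R]_d => enorm (x - a)).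
Proof.
move=> x; apply: (@continuous_comp _ _ _ (fun x : 'rV[R]_d => x - a)).
  by apply: (@continuousB R _ _ id (cst a)); [move=> ? | exact: cst_continuous].
exact: continuous_enorm.
Qed.

Lemma closed_eball (R : realType) d (a : 'rV[R]_d) (r : R) :
  closed [set x : 'rV[R]_d | enorm (x - a) <= r].
Proof.
by apply: (@preimage_closed _ _ (fun x : 'rV[R]_d => enorm (x - a))
  [set y | y <= r]) => [x _|];
  [exact: continuous_enormB | exact: closed_le].
Qed.

Lemma open_eball (R : realType) d (a : 'rV[R]_d) (r : R) :
  open [set x : 'rV[R]_d | enorm (x - a) < r].
Proof.
by apply: (@open_comp _ _ (fun x : 'rV[R]_d => enorm (x - a))
  [set y | y < r]) => [x _|];
  [exact: continuous_enormB | exact: open_lt].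
Qed.

(** * Hausdorff distance and Hoelder multifunctions *)

(** Attainment turns the Hoelder bound into an inequality without slack, which is
    essential when the Hoelder constant is 0: no slack could be absorbed then. *)
Lemma set_dist_attained (R : realType) d (A : set 'rV[R]_d) (x : 'rV[R]_d) :
  nonempty_compacts A -> exists2 a, A a & (set_dist x A = (enorm (x - a))%:E).
Proof.
move=> [A0 cA].
have [|a + amin] := @compact_EVT_min _ _ (fun a : 'rV[R]_d => enorm (a - x)) A
  A0 cA.
  by apply: continuous_subspaceT; exact: continuous_enormB.
rewrite inE => Aa; exists a => //; apply/eqP; rewrite eq_le; apply/andP; split.
  by apply: ereal_inf_lbound; exists a.
apply: le_ereal_inf_tmp => _ [b Ab <-].
by rewrite lee_fin enormB (enormB x); apply: amin; rewrite inE.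
Qed.

Lemma hausdorff_dist_ge0 (R : realType) d (A B : set 'rV[R]_d) :
  nonempty_compacts A -> (0 <= hausdorff_dist A B)%E.
Proof.
move=> [[a Aa] _]; rewrite /hausdorff_dist le_max; apply/orP; left.
apply: (@le_trans _ _ (set_dist a B)).
  by apply: le_ereal_inf_tmp => _ [b Bb <-]; rewrite lee_fin enorm_ge0.
by apply: ereal_sup_ubound; exists a.
Qed.

Lemma holder_coef_ge0 (R : realType) d (T gamma : R) (F : R -> set 'rV[R]_d) :
  0 < T -> (forall t, t \in `[0, T] -> nonempty_compacts (F t)) ->
  (0 <= holder_coef T gamma F)%E.
Proof.
move=> T0 FK.
have h0 : (0 : R) \in `[0, T] by rewrite in_itv/= lexx ltW.
have hT : T \in `[0, T] by rewrite in_itv/= lexx ltW.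
have /le_trans : (0 <= hausdorff_dist (F 0%R) (F T)
    * ((`|T - 0| `^ gamma)^-1)%:E)%E.
  by rewrite mule_ge0 ?hausdorff_dist_ge0 ?lee_fin ?invr_ge0 ?powR_ge0//; exact: FK.
apply.
by apply: ereal_sup_ubound; exists 0, T; split=> //; rewrite lt_eqF.
Qed.

(** The pointwise form of Hoelder continuity, which can be iterated along a chain of
    times. *)
Definition holder_reachable (R : realType) d (T gamma H : R)
    (F : R -> set 'rV[R]_d) :=
  forall s t x, s \in `[0, T] -> t \in `[0, T] -> F s x ->
  exists2 a, F t a & enorm (x - a) <= H * `|t - s| `^ gamma.

Lemma holder_nearest (R : realType) d (T gamma H : R) (F : R -> set 'rV[R]_d) :
  0 < gamma -> (forall t, t \in `[0, T] -> nonempty_compacts (F t)) ->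
  holder_coef T gamma F = H%:E ->
  holder_reachable T gamma H F.
Proof.
move=> gamma0 FK FH s t x sT tT Fsx.
have [<-|st] := eqVneq s t.
  by exists x => //; rewrite !subrr enorm0 normr0 powR0 ?gt_eqF// mulr0.
have [a Fta xa] := set_dist_attained x (FK _ tT).
exists a => //; rewrite -lee_fin -xa.
have ts0 : 0 < `|t - s| `^ gamma by rewrite powR_gt0// normr_gt0 subr_eq0 eq_sym.
apply: (@le_trans _ _ (hausdorff_dist (F s) (F t))).
  rewrite /hausdorff_dist le_max; apply/orP; left.
  by apply: ereal_sup_ubound; exists x.
rewrite EFinM -lee_pdivrMr// -FH.
by apply: ereal_sup_ubound; exists s, t; split.
Qed.

(** * Measurable approximate projections onto a compact set *)

Lemma measurable_eball (R : realType) d (a : 'rV[R]_d) (r : R) :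
  @measurable _ (borelRd R d) [set x | enorm (x - a) <= r].
Proof.
rewrite -[X in measurable X]setCK; apply: measurableC.
by apply: sub_sigma_algebra; exact/closed_openC/closed_eball.
Qed.

Lemma compact_net (R : realType) d (K : set 'rV[R]_d) (eta : R) :
  compact K -> 0 < eta ->
  exists s : seq 'rV[R]_d, (forall b, b \in s -> K b) /\
    forall a, K a -> exists2 b, b \in s & enorm (a - b) <= eta.
Proof.
rewrite compact_cover => cK eta0.
have [||D DK cover] := cK 'rV[R]_d K (fun b => [set x | enorm (x - b) < eta]).
- by move=> b _; exact: open_eball.
- by move=> x Kx; exists x => //=; rewrite subrr enorm0.
- exists (finmap.enum_fset D); split=> [b /DK|a /cover[b Db]]; first by rewrite inE.
  by move=> /ltW ?; exists b.
Qed.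

(** Taking the first admissible point of a finite list makes the choice a simple
    Borel function, except that points far from the whole list are left fixed. *)
Fixpoint first_within (R : realType) d (r : R) (s : seq 'rV[R]_d)
    (x : 'rV[R]_d) : 'rV[R]_d :=
  if s is b :: s' then if enorm (x - b) <= r then b else first_within r s' x
  else x.

Lemma measurable_first_within (R : realType) d (r : R) (s : seq 'rV[R]_d) :
  measurable_fun setT (first_within r s : borelRd R d -> borelRd R d).
Proof.
elim: s => [|b s ih] /=; first exact: measurable_id.
apply: measurable_fun_ifT => //=.
apply: (@measurable_fun_bool _ _ _ _ true).
by rewrite setTI; exact: measurable_eball.
Qed.

Lemma first_within_spec (R : realType) d (r : R) (s : seq 'rV[R]_d) x :
  (exists2 b, b \in s & enorm (x - b) <= r) ->
  first_within r s x \in s /\ enorm (first_within r s x - x) <= r.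
Proof.
elim: s => [|b s ih] [c cs xc]//=; case: ifPn => [xb|xb].
  by rewrite mem_head enormB.
have [|ins ?] := ih; last by rewrite in_cons ins orbT.
by move: cs; rewrite in_cons => /predU1P[cb|cs]; [rewrite -cb xc in xb|exists c].
Qed.

(** Giving up a factor 2 in the distance allows the target to be a point of a finite
    [eta]-net of [K], and so avoids measurable selection of a nearest point. For
    [eta = 0] the points concerned already lie in [K] and the identity serves. *)
Lemma measurable_near_projection (R : realType) d (K : set 'rV[R]_d) (eta : R) :
  compact K -> 0 <= eta ->
  exists P : 'rV[R]_d -> 'rV[R]_d,
    measurable_fun setT (P : borelRd R d -> borelRd R d) /\
    forall x, (exists2 a, K a & enorm (x - a) <= eta) ->
      K (P x) /\ enorm (P x - x) <= 2 * eta.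
Proof.
move=> cK; rewrite le_eqVlt => /predU1P[<-|eta0].
  exists id; split=> [|x [a Ka xa]]; first exact: measurable_id.
  rewrite subrr enorm0 mulr0; split=> //; suff -> : x = a by [].
  apply/eqP; rewrite -subr_eq0 -normr_le0.
  exact: le_trans (norm_le_enorm _) xa.
have [s [sK net]] := compact_net cK eta0.
exists (first_within (2 * eta) s); split; first exact: measurable_first_within.
move=> x [a Ka xa]; have [b bs ab] := net a Ka.
have [|/sK ? ?] := @first_within_spec R d (2 * eta) s x; last by [].
exists b => //; apply: (le_trans (enorm_le_trans a _ _)); lra.
Qed.

(** * Dyadic cells *)

(** The grid covers [0, 2T], so that [0, T] lies in a single cell of rank 0 and the
    endpoint T is a grid point of rank 1, with ancestor 0. *)
Definition mesh (R : realType) (T : R) (n : nat) : R := 2 * T / 2 ^+ n.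

Definition cell (R : realType) (T : R) (n : nat) (t : R) : nat :=
  Num.truncn (t / mesh T n).

Lemma mesh_gt0 (R : realType) (T : R) n : 0 < T -> 0 < mesh T n.
Proof. by move=> T0; rewrite divr_gt0 ?mulr_gt0// exprn_gt0. Qed.

Lemma meshS (R : realType) (T : R) n : mesh T n = 2 * mesh T n.+1.
Proof.
rewrite /mesh exprS; have : (2 : R) ^+ n != 0 by rewrite expf_neq0.
by move=> ?; field.
Qed.

Lemma cellP (R : realType) (T : R) n k (t : R) : 0 < T -> 0 <= t ->
  (cell T n t == k) = (k%:R * mesh T n <= t < k.+1%:R * mesh T n).
Proof.
move=> T0 t0; have m0 := mesh_gt0 n T0.
rewrite /cell (truncn_eq _ (divr_ge0 t0 (ltW m0))).
by rewrite ler_pdivlMr// ltr_pdivrMr.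
Qed.

Lemma cell_itv (R : realType) (T : R) n (t : R) : 0 < T -> 0 <= t ->
  (cell T n t)%:R * mesh T n <= t < (cell T n t).+1%:R * mesh T n.
Proof. by move=> T0 t0; rewrite -cellP. Qed.

Lemma cell_at0 (R : realType) (T : R) n : cell T n 0 = 0.
Proof. by rewrite /cell mul0r truncn0. Qed.

Lemma cell_root (R : realType) (T t : R) : 0 < T -> t \in `[0, T] ->
  cell T 0 t = 0%N.
Proof.
move=> T0; rewrite in_itv/= => /andP[t0 tT].
by apply/eqP; rewrite cellP// /mesh expr0; apply/andP; split; lra.
Qed.

(** Cells are nested: dropping the last binary digit of the index of a cell gives the
    index of the coarser cell that contains it. *)
Lemma cell_half (R : realType) (T : R) n (t : R) : 0 < T -> 0 <= t ->
  (cell T n.+1 t)./2 = cell T n t.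
Proof.
move=> T0 t0; apply/esym/eqP; rewrite cellP// meshS.
have /andP[lo hi] := cell_itv n.+1 T0 t0; have m0 := mesh_gt0 n.+1 T0.
move: (mesh T n.+1) (cell T n.+1 t) lo hi m0 => m k lo hi m0.
rewrite !mulrA -!natrM !muln2; apply/andP; split.
  apply: le_trans lo; rewrite ler_pM2r// ler_nat.
  by rewrite -[leqRHS](odd_double_half k) leq_addl.
apply: (lt_le_trans hi); rewrite ler_pM2r// ler_nat -[leqLHS]/(k.+1).
by rewrite -[in leqLHS](odd_double_half k) doubleS; case: odd.
Qed.

Lemma cell_le (R : realType) (T : R) n (s t : R) : 0 < T -> s <= t ->
  (cell T n s <= cell T n t)%N.
Proof.
by move=> T0 st; rewrite le_truncn// ler_pM2r// invr_gt0 mesh_gt0.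
Qed.

Lemma cell_le_exp (R : realType) (T : R) n (t : R) : 0 < T -> t <= T ->
  (cell T n t <= 2 ^ n)%N.
Proof.
move=> T0 tT; apply: leq_trans (cell_le n T0 tT) _.
rewrite /cell truncn_le_nat -natr1 natrX /mesh.
have p0 : (0 : R) < 2 ^+ n by rewrite exprn_gt0.
have -> : T / (2 * T / 2 ^+ n) = 2 ^+ n / 2 by field; rewrite !gt_eqF.
lra.
Qed.

(** Two distinct times lie in distinct cells once the mesh is below their gap; the
    explicit rank comes from [n < 2 ^ n]. *)
Lemma cell_separates (R : realType) (T s t : R) : 0 < T -> 0 <= s -> s < t ->
  exists n, cell T n s != cell T n t.
Proof.
move=> T0 s0 st; have t0 : 0 <= t by exact: le_trans (ltW st).
pose n := Num.truncn (2 * T / (t - s)).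
have ts : 0 < t - s by rewrite subr_gt0.
have mn : mesh T n < t - s.
  rewrite /mesh ltr_pdivrMr ?exprn_gt0// [ltRHS]mulrC -ltr_pdivrMr//.
  apply: (lt_le_trans (truncnS_gt _)).
  by rewrite -(natrX _ 2 n) ler_nat ltn_expl.
exists n; apply/eqP => e.
have /andP[+ _] := cell_itv n T0 s0; have /andP[_ +] := cell_itv n T0 t0.
rewrite e -natr1 mulrDl mul1r; lra.
Qed.

Lemma powR_mesh (R : realType) (T gamma : R) n : 0 < T ->
  mesh T n `^ gamma = (2 * T) `^ gamma * (2 `^ (- gamma)) ^+ n.
Proof.
move=> T0; rewrite /mesh powRM ?invr_ge0 ?exprn_ge0 ?mulr_ge0 ?(ltW T0)//.
congr (_ * _).
rewrite -powR_mulrn ?powR_ge0// -powR_mulrn// -powRN -!powRrM.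
by congr (_ `^ _); ring.
Qed.

(** * Paths with geometrically small oscillation on dyadic cells *)

Lemma geometric_small (R : realType) (A q e : R) : 0 <= q < 1 -> 0 < e ->
  exists n, A * q ^+ n < e.
Proof.
move=> /andP[q0 q1] e0.
have /cvgrPdist_lt/(_ e e0)[n _ /(_ n (leqnn n))] :
  geometric A q @ \oo --> 0 by apply: cvg_geometric; rewrite ger0_norm.
by rewrite /= sub0r normrN => h; exists n; exact: le_lt_trans (ler_norm _) h.
Qed.

(** The bound at rank [n] says nothing about times in different cells of rank [n],
    however close they are: the path may jump at every dyadic time. *)
Definition cell_oscillation (R : realType) d (T A q : R) (f : R -> 'rV[R]_d) :=
  forall n s t, s \in `[0, T] -> t \in `[0, T] -> cell T n s = cell T n t ->
    enorm (f t - f s) <= A * q ^+ n.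

(** At the first rank [n] that separates [s] from [t] the two times still share their
    cell of rank [n.-1], which bounds the increment by [A / q * q ^+ n]; and the cell
    index of rank [n] increases by at least 1. That increase is kept as a factor
    because it telescopes along a partition. *)
Lemma cell_oscillation_increment (R : realType) d (T A q p : R)
    (f : R -> 'rV[R]_d) s t :
  0 < T -> 0 <= A -> 0 < q -> 0 <= p -> cell_oscillation T A q f ->
  s \in `[0, T] -> t \in `[0, T] -> s < t ->
  exists n, enorm (f t - f s) `^ p <=
    (A / q) `^ p * (q `^ p) ^+ n * ((cell T n t)%:R - (cell T n s)%:R).
Proof.
move=> T0 A0 q0 p0 osc sT tT st.
move: (sT) (tT); rewrite !in_itv/= => /andP[s0 sT'] /andP[t0 tT'].
case: (ex_minnP (cell_separates T0 s0 st)) => n nst nmin.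
have n0 : (0 < n)%N.
  rewrite lt0n; apply: contra nst => /eqP ->.
  by rewrite !cell_root.
case: n n0 nst nmin => // n _ nst nmin; exists n.+1.
have same : cell T n s = cell T n t.
  by apply/eqP/negPn/negP => /nmin; rewrite ltnn.
have jump : 1 <= (cell T n.+1 t)%:R - (cell T n.+1 s)%:R :> R.
  rewrite -natrB ?(cell_le _ _ (ltW st))// ler1n subn_gt0 ltn_neqAle nst.
  exact: cell_le (ltW st).
apply: (@le_trans _ _ ((A / q) `^ p * (q `^ p) ^+ n.+1)); last first.
  by rewrite ler_peMr// mulr_ge0 ?exprn_ge0 ?powR_ge0.
have -> : (q `^ p) ^+ n.+1 = (q ^+ n.+1) `^ p.
  by rewrite -!powR_mulrn ?powR_ge0 ?(ltW q0)// -!powRrM mulrC.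
rewrite -powRM ?divr_ge0 ?exprn_ge0 ?(ltW q0)//.
have -> : A / q * q ^+ n.+1 = A * q ^+ n by rewrite exprS; field; rewrite gt_eqF.
by rewrite ge0_ler_powR ?nnegrE ?enorm_ge0 ?mulr_ge0 ?exprn_ge0 ?(ltW q0)//; exact: osc.
Qed.

(** The increments first separated at rank [n] number at most [2 ^ n], because the
    cell index of rank [n] is monotone and at most [2 ^ n] on [0, T]; each contributes
    at most [(A / q * q ^+ n) `^ p]. The sum over [n] is a geometric series of ratio
    [2 * q `^ p]. *)
Lemma p_variation_cell_oscillation (R : realType) d (T A q p : R)
    (f : R -> 'rV[R]_d) :
  0 < T -> 0 <= A -> 0 < q -> 0 < p -> 2 * q `^ p < 1 ->
  cell_oscillation T A q f ->
  (p_variation T p f <= (A / q * (1 - 2 * q `^ p)^-1 `^ p^-1)%:E)%E.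
Proof.
move=> T0 A0 q0 p0 qp osc.
apply: ge_ereal_sup => _ [m [sigma [sigmaT sigma_lt ->]]]; rewrite lee_fin.
set c := (A / q) `^ p; set r := q `^ p in qp *.
have r0 : 0 <= r by exact: powR_ge0.
have c0 : 0 <= c by exact: powR_ge0.
pose gap n k : R := (cell T n (sigma k.+1))%:R - (cell T n (sigma k))%:R.
have gap0 n k : (k < m)%N -> 0 <= gap n k.
  by move=> km; rewrite subr_ge0 ler_nat cell_le// ltW// sigma_lt.
have /choice[rk rkP] : forall k, exists n, (k < m)%N ->
    enorm (f (sigma k.+1) - f (sigma k)) `^ p <= c * r ^+ n * gap n k.
  move=> k; have [km|km] := ltnP k m; last by exists 0%N.
  have [n ?] := cell_oscillation_increment T0 A0 q0 (ltW p0) osc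
    (sigmaT _ (ltnW km)) (sigmaT _ km) (sigma_lt _ km).
  by exists n.
pose N := (\max_(k < m) rk k).+1.
have incr k : (k < m)%N -> enorm (f (sigma k.+1) - f (sigma k)) `^ p <=
    \sum_(n < N) c * r ^+ n * gap n k.
  move=> km; have kN : (rk k < N)%N by exact: (leq_bigmax (Ordinal km)).
  rewrite (bigD1 (Ordinal kN))//=; apply: (le_trans (rkP k km)).
  by rewrite lerDl sumr_ge0// => n _; rewrite !mulr_ge0 ?exprn_ge0 ?gap0.
have total : \sum_(k < m) enorm (f (sigma k.+1) - f (sigma k)) `^ p <=
    c * (1 - 2 * r)^-1.
  apply: (@le_trans _ _ (\sum_(k < m) \sum_(n < N) c * r ^+ n * gap n k)).
    by apply: ler_sum => k _; exact: incr.
  rewrite exchange_big /=.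
  apply: (@le_trans _ _ (series (geometric c (2 * r)) N)); last first.
    by apply: geometric_le_lim => //; rewrite ?mulr_gt0 ?powR_gt0// ger0_norm ?mulr_ge0.
  rewrite /series/= big_mkord; apply: ler_sum => n _.
  rewrite -mulr_sumr -(big_mkord xpredT (gap n)).
  rewrite (telescope_sumr (fun k => (cell T n (sigma k))%:R : R))//.
  rewrite exprMn [_ ^+ n * r ^+ n]mulrC mulrA ler_wpM2l ?mulr_ge0 ?exprn_ge0//.
  apply: (@le_trans _ _ (cell T n (sigma m))%:R); first by rewrite gerBl.
  rewrite -natrX ler_nat cell_le_exp//.
  by have := sigmaT m (leqnn m); rewrite in_itv/= => /andP[].
apply: (@le_trans _ _ ((c * (1 - 2 * r)^-1) `^ p^-1)).
  rewrite ge0_ler_powR ?nnegrE ?invr_ge0 ?(ltW p0)//.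
    by apply: sumr_ge0 => k _; exact: powR_ge0.
  by rewrite mulr_ge0 ?invr_ge0 ?subr_ge0 ?(ltW qp).
rewrite powRM// ?invr_ge0 ?subr_ge0 ?(ltW qp)// /c -powRrM mulfV ?gt_eqF//.
by rewrite powRr1// divr_ge0 ?(ltW q0).
Qed.

(** The cells are closed on the left and open on the right: to the right of [t] the
    path stays in the cell of [t], and to the left of [t] it stays in the cell that
    meets every left neighbourhood of [t], which may be the preceding one. *)
Lemma cadlag_cell_oscillation (R : realType) d (T A q : R) (f : R -> 'rV[R]_d) :
  0 < T -> 0 <= q < 1 -> cell_oscillation T A q f -> cadlag T f.
Proof.
move=> T0 q01 osc; split=> [t /andP[t0 tT]|t /andP[t0 tT]].
  apply/cvgrPdist_le => e e0; have [n nA] := geometric_small A q01 e0.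
  have /andP[lo hi] := cell_itv n T0 t0.
  near=> s.
  have ts : t < s by near: s; exact: nbhs_right_gt.
  have sT : s < T by near: s; exact: nbhs_right_lt.
  have s_hi : s < (cell T n t).+1%:R * mesh T n.
    by near: s; exact: nbhs_right_lt.
  apply: (le_trans (norm_le_enorm _)); apply: le_trans (ltW nA).
  apply: osc; rewrite ?in_itv/= ?t0 ?(ltW tT) ?(ltW sT) ?(le_trans t0 (ltW ts))//.
  apply/eqP; rewrite cellP// ?(le_trans t0 (ltW ts))//.
  by rewrite s_hi (le_trans lo (ltW ts)).
apply/cauchy_cvgP; apply: cauchy_exP => e e0.
have [n nA] := geometric_small A q01 e0; have m0 := mesh_gt0 n T0.
have cover : exists k, t <= k.+1%:R * mesh T n.
  by exists (cell T n t); have /andP[_ /ltW] := cell_itv n T0 (ltW t0).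
(* Minimality of [k] gives the cell with [k * mesh < t <= (k + 1) * mesh]. *)
case: (ex_minnP cover) => k tk kmin.
have kt : k%:R * mesh T n < t.
  rewrite ltNge; apply/negP => tk'; case: k kmin tk tk' => [|k] kmin tk tk'.
    by move: tk'; rewrite mul0r leNgt t0.
  by have := kmin k tk'; rewrite ltnn.
have k0 : 0 <= k%:R * mesh T n by rewrite mulr_ge0// ltW.
have left_cell s : k%:R * mesh T n < s < t -> s \in `[0, T] /\ cell T n s = k.
  move=> /andP[ks st]; have s0 := le_trans k0 (ltW ks).
  split; first by rewrite in_itv/= s0 (le_trans (ltW st) tT).
  by apply/eqP; rewrite cellP// (ltW ks) (lt_le_trans st tk).
pose s0 := (k%:R * mesh T n + t) / 2.
have [s0T s0k] : s0 \in `[0, T] /\ cell T n s0 = k.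
  by apply: left_cell; rewrite /s0; apply/andP; split; lra.
exists (f s0).
suff: \forall s \near t^'-, ball (f s0) e (f s) by [].
near=> s.
have [sT sk] : s \in `[0, T] /\ cell T n s = k.
  apply: left_cell; apply/andP; split; near: s.
    exact: nbhs_left_gt.
  exact: nbhs_left_lt.
rewrite -ball_normE /=; apply: (le_lt_trans (norm_le_enorm _)).
by apply: le_lt_trans nA; apply: osc; rewrite ?sk ?s0k.
Unshelve. all: by end_near. Qed.

(** For [U] open, [f x] is in [U] iff, for some [n], a neighbourhood of [u n x] and its
    closed [b n]-enlargement lie in [U]; this is a countable union of preimages of open
    sets under the functions [u n]. *)
Lemma measurable_uniform_limit (R : realType) d (D : set 'rV[R]_d)
    (u : nat -> 'rV[R]_d -> 'rV[R]_d) (f : 'rV[R]_d -> 'rV[R]_d) (b : nat -> R) :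
  (forall n, measurable_fun (D : set (borelRd R d))
    (u n : borelRd R d -> borelRd R d)) ->
  (forall n x, D x -> enorm (f x - u n x) <= b n) ->
  (forall e, 0 < e -> exists n, b n < e) ->
  measurable_fun (D : set (borelRd R d)) (f : borelRd R d -> borelRd R d).
Proof.
move=> mu ub b0 mD; move: (mD).
apply: (@measurability _ _ (borelRd R d) (borelRd R d) D f
  (@open 'rV[R]_d)) => // _ [U oU <-].
pose V n := interior [set x : 'rV[R]_d | forall y, enorm (x - y) <= b n -> U y].
have -> : D `&` f @^-1` U = \bigcup_n (D `&` u n @^-1` (V n)).
  apply/seteqP; split=> [x [Dx Ufx]|x [n _ [Dx /interior_subset Vx]]]; last first.
    by split=> //; apply: Vx; rewrite enormB ub.
  have /nbhs_ballP[e /= e0 eU] : nbhs (f x) U by exact: open_nbhs_nbhs.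
  have e4 : 0 < e / 4 by rewrite divr_gt0.
  have [n bn] := b0 _ e4; exists n => //; split=> //=.
  apply/nbhs_ballP; exists (e / 2) => /=; first by rewrite divr_gt0.
  move=> z; rewrite -ball_normE /= => xz y zy; apply: eU; rewrite -ball_normE /=.
  have -> : f x - y = (f x - u n x) + (u n x - z) + (z - y).
    by rewrite !addrA !subrK.
  apply: (le_lt_trans (ler_normD _ _)).
  have := ler_normD (f x - u n x) (u n x - z).
  have := norm_le_enorm (f x - u n x); have := norm_le_enorm (z - y).
  have := ub n x Dx; lra.
apply: bigcupT_measurable => n; apply: mu => //.
by apply: sub_sigma_algebra; exact: open_interior.
Qed.

Lemma compact_adherent (R : realType) d (K : set 'rV[R]_d) (x : 'rV[R]_d) :
  nonempty_compacts K ->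
  (forall e, 0 < e -> exists2 a, K a & enorm (x - a) < e) -> K x.
Proof.
move=> cK adh; have [a Ka xa] := set_dist_attained x cK.
suff -> : x = a by [].
apply/eqP; rewrite -subr_eq0; apply/negPn/negP; rewrite -enorm_gt0 => /adh[b Kb].
apply/negP; rewrite -leNgt -lee_fin -xa.
by apply: ereal_inf_lbound; exists b.
Qed.

(** The bound on the steps telescopes, which is why it is stated as a difference. *)
Lemma geometric_steps_limit (R : realType) d (u : nat -> 'rV[R]_d) (c q : R) :
  0 <= c -> 0 <= q < 1 ->
  (forall n, enorm (u n.+1 - u n) <= c * (q ^+ n - q ^+ n.+1)) ->
  forall n, enorm (lim (u @ \oo) - u n) <= c * q ^+ n.
Proof.
move=> c0 q01 step.
have close n m : (n <= m)%N -> enorm (u m - u n) <= c * q ^+ n.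
  move=> nm; apply: (@le_trans _ _ (c * (q ^+ n - q ^+ m))); last first.
    have /andP[q0 _] := q01; have := exprn_ge0 m q0 => qm0.
    by rewrite ler_wpM2l// gerBl.
  elim: m nm => [|m ih]; first by rewrite leqn0 => /eqP ->; rewrite !subrr enorm0 mulr0.
  rewrite leq_eqVlt => /predU1P[->|/ih {}ih]; first by rewrite !subrr enorm0 mulr0.
  apply: (le_trans (enorm_le_trans (u m) _ _)).
  by apply: (le_trans (lerD (step m) ih)); rewrite -mulrDr; lra.
have cvgu : cvg (u @ \oo).
  apply/cauchy_cvgP; apply: cauchy_exP => e e0.
  have [n nA] := geometric_small c q01 e0.
  exists (u n), n => // m /= nm; rewrite -ball_normE /=.
  apply: (le_lt_trans (norm_le_enorm _)); rewrite enormB.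
  exact: le_lt_trans (close _ _ nm) nA.
move=> n; pose B := [set x : 'rV[R]_d | enorm (x - u n) <= c * q ^+ n].
suff : B (lim (u @ \oo)) by [].
apply: (@closed_cvg _ _ _ _ u B _ _ _ cvgu); first exact: closed_eball.
by exists n => // m /= /close.
Qed.

(** * The dyadic tree of points *)

(** The vertex [k] of rank [n] stands for the time [k * mesh T n]. An even [k] is a
    time already present at rank [n.-1] and keeps its point; an odd [k] is a new time,
    whose point is obtained from the vertex [k./2] immediately to its left at rank
    [n.-1]. Nothing relates it to the neighbour on its right, so the limit path may
    jump at every dyadic time. *)
Fixpoint tree_point (V : Type) (P : nat -> nat -> V -> V) (n k : nat) (w : V) : V :=
  if n is n'.+1 then
    let x := tree_point P n' k./2 w in if odd k then P n k x else x
  else w.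

Lemma tree_point0 (V : Type) (P : nat -> nat -> V -> V) n w :
  tree_point P n 0 w = w.
Proof. by elim: n => //= n ->. Qed.

Lemma measurable_tree_point (R : realType) d
    (P : nat -> nat -> 'rV[R]_d -> 'rV[R]_d) :
  (forall n k, measurable_fun setT (P n k : borelRd R d -> borelRd R d)) ->
  forall n k, measurable_fun setT (tree_point P n k : borelRd R d -> borelRd R d).
Proof.
move=> mP; elim=> [|n ih] k /=; first exact: measurable_id.
by case: odd; [exact: (measurableT_comp (mP n.+1 k) (ih k./2)) | exact: ih].
Qed.

Definition tree_projections (R : realType) d (T gamma H : R)
    (F : R -> set 'rV[R]_d) (P : nat -> nat -> 'rV[R]_d -> 'rV[R]_d) :=
  forall n k x, k%:R * mesh T n \in `[0, T] ->
    (exists2 a, F (k%:R * mesh T n) a & enorm (x - a) <= H * mesh T n `^ gamma) ->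
    F (k%:R * mesh T n) (P n k x) /\
    enorm (P n k x - x) <= 2 * (H * mesh T n `^ gamma).

(** At grid times beyond [T] nothing is known about [F], and the identity is chosen. *)
Lemma exists_tree_projections (R : realType) d (T gamma H : R)
    (F : R -> set 'rV[R]_d) :
  0 <= H -> (forall t, t \in `[0, T] -> nonempty_compacts (F t)) ->
  exists P, tree_projections T gamma H F P /\
    forall n k, measurable_fun setT (P n k : borelRd R d -> borelRd R d).
Proof.
move=> H0 FK.
have /choice[P hP] : forall nk : nat * nat, exists P : 'rV[R]_d -> 'rV[R]_d,
    (forall x, nk.2%:R * mesh T nk.1 \in `[0, T] ->
    (exists2 a, F (nk.2%:R * mesh T nk.1) a &
       enorm (x - a) <= H * mesh T nk.1 `^ gamma) ->
    F (nk.2%:R * mesh T nk.1) (P x) /\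
    enorm (P x - x) <= 2 * (H * mesh T nk.1 `^ gamma)) /\
    measurable_fun setT (P : borelRd R d -> borelRd R d).
  move=> [n k] /=; have [kT|kT] := boolP (k%:R * mesh T n \in `[0, T]); last first.
    by exists id; split; [move=> x kT'; rewrite kT' in kT | exact: measurable_id].
  have [P [mP hP]] := measurable_near_projection (proj2 (FK _ kT))
    (mulr_ge0 H0 (powR_ge0 (mesh T n) gamma)).
  by exists P; split=> // x _; exact: hP.
exists (fun n k => P (n, k)); split=> [n k|n k]; last exact: (hP (n, k)).2.
exact: (hP (n, k)).1.
Qed.

Lemma cell_left_in (R : realType) (T t : R) n : 0 < T -> t \in `[0, T] ->
  (cell T n t)%:R * mesh T n \in `[0, T].
Proof.
move=> T0; rewrite !in_itv/= => /andP[t0 tT].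
have /andP[lo _] := cell_itv n T0 t0.
by rewrite mulr_ge0 ?(ltW (mesh_gt0 _ T0))// (le_trans lo tT).
Qed.

(** A vertex and its parent are at most [mesh T n.+1] apart in time, so the points of
    the branch that descends to [t] belong to [F] at the left ends of the cells of [t]
    and their steps decrease geometrically. *)
Lemma tree_point_spec (R : realType) d (T gamma H : R) (F : R -> set 'rV[R]_d) P w t :
  0 < T -> 0 <= H ->
  holder_reachable T gamma H F ->
  tree_projections T gamma H F P -> F 0 w -> t \in `[0, T] ->
  forall n,
    F ((cell T n t)%:R * mesh T n) (tree_point P n (cell T n t) w) /\
    enorm (tree_point P n.+1 (cell T n.+1 t) w - tree_point P n (cell T n t) w)
      <= 2 * (H * mesh T n.+1 `^ gamma).
Proof.
move=> T0 H0 reach hP Fw tT.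
have t0 : 0 <= t by move: tT; rewrite in_itv/= => /andP[].
have step n : F ((cell T n t)%:R * mesh T n) (tree_point P n (cell T n t) w) ->
    F ((cell T n.+1 t)%:R * mesh T n.+1) (tree_point P n.+1 (cell T n.+1 t) w) /\
    enorm (tree_point P n.+1 (cell T n.+1 t) w - tree_point P n (cell T n t) w)
      <= 2 * (H * mesh T n.+1 `^ gamma).
  move=> Fn /=; rewrite cell_half//.
  have parent : (cell T n.+1 t)%:R * mesh T n.+1 =
      (odd (cell T n.+1 t))%:R * mesh T n.+1 + (cell T n t)%:R * mesh T n.
    rewrite -(cell_half n T0 t0) (meshS T n) -{1}(odd_double_half (cell T n.+1 t)).
    by rewrite natrD -muln2 natrM; ring.
  case: ifPn parent => _ /=; rewrite (mul0r, mul1r) => parent; last first.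
    rewrite parent add0r subrr enorm0; split=> //.
    by rewrite !mulr_ge0 ?powR_ge0.
  apply: hP; first exact: cell_left_in.
  have [a Fa xa] := reach _ _ _ (cell_left_in n T0 tT) (cell_left_in n.+1 T0 tT) Fn.
  by exists a => //; move: xa; rewrite parent addrK ger0_norm// ltW// mesh_gt0.
suff Fn n : F ((cell T n t)%:R * mesh T n) (tree_point P n (cell T n t) w).
  by move=> n; split; [exact: Fn | exact: (step n (Fn n)).2].
elim: n => [|n ih]; last exact: (step n ih).1.
by rewrite cell_root// mul0r.
Qed.

(** * The selection *)

Lemma powR2_gt1 (R : realType) (a : R) : 0 < a -> 1 < 2 `^ a.
Proof.
move=> a0; suff : 1 `^ a < 2 `^ a :> R by rewrite powR1.
by rewrite gt0_ltr_powR ?nnegrE// ltr1n.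
Qed.

Lemma half_powR_lt1 (R : realType) (gamma : R) : 0 < gamma -> 2 `^ (- gamma) < 1.
Proof. by move=> g0; rewrite powRN invf_lt1 ?powR_gt0 ?powR2_gt1. Qed.

(** The ratio is [2 `^ (1 - gamma * p)]: this is why the p-variation is finite beyond
    the exponent [gamma^-1]. *)
Lemma variation_ratio_lt1 (R : realType) (gamma p : R) : 0 < gamma ->
  gamma^-1 < p -> 2 * (2 `^ (- gamma)) `^ p < 1.
Proof.
move=> g0 gp.
have gp1 : 0 < gamma * p - 1 by rewrite subr_gt0 mulrC -ltr_pdivrMr// div1r.
rewrite -powRrM -[X in X * _](@powRr1 _ 2)// -powRD ?pnatr_eq0 ?implybT//.
have -> : 1 + - gamma * p = - (gamma * p - 1) by ring.
exact: half_powR_lt1.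
Qed.

Definition tree_selection (R : realType) d (T : R)
    (P : nat -> nat -> 'rV[R]_d -> 'rV[R]_d) (w : 'rV[R]_d) (t : R) : 'rV[R]_d :=
  lim ((fun n => tree_point P n (cell T n t) w) @ \oo).

Lemma tree_selection_approx (R : realType) d (T gamma H : R)
    (F : R -> set 'rV[R]_d) P w t (q := 2 `^ (- gamma)) :
  0 < T -> 0 < gamma -> 0 <= H ->
  holder_reachable T gamma H F ->
  tree_projections T gamma H F P -> F 0 w -> t \in `[0, T] ->
  forall n, enorm (tree_selection T P w t - tree_point P n (cell T n t) w) <=
    2 * H * (2 * T) `^ gamma * q / (1 - q) * q ^+ n.
Proof.
move=> T0 g0 H0 reach hP Fw tT.
have q1 : q < 1 by exact: half_powR_lt1.
have q0 : 0 <= q by exact: powR_ge0.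
(* The constant [c] solves [c * (q ^+ n - q ^+ n.+1) = 2 * H * mesh T n.+1 `^ gamma]. *)
apply: geometric_steps_limit => [||n]; last 2 first.
- by rewrite q0.
- have [_ /le_trans] := tree_point_spec T0 H0 reach hP Fw tT n; apply.
  rewrite powR_mesh// -/q exprS le_eqVlt; apply/orP; left; apply/eqP.
  by field; rewrite subr_eq0 gt_eqF.
- by rewrite divr_ge0 ?subr_ge0 ?(ltW q1)// !mulr_ge0 ?powR_ge0// ltW.
Qed.

(** The approximating points lie in values of [F] at times that tend to [t], hence
    are asymptotically close to the compact set [F t]. *)
Lemma tree_selection_in (R : realType) d (T gamma H : R)
    (F : R -> set 'rV[R]_d) P w t :
  0 < T -> 0 < gamma -> 0 <= H ->
  (forall t, t \in `[0, T] -> nonempty_compacts (F t)) ->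
  holder_reachable T gamma H F ->
  tree_projections T gamma H F P -> F 0 w -> t \in `[0, T] ->
  F t (tree_selection T P w t).
Proof.
move=> T0 g0 H0 FK reach hP Fw tT; apply: (compact_adherent (FK _ tT)) => e e0.
set q : R := 2 `^ (- gamma).
have q01 : 0 <= q < 1 by rewrite powR_ge0 half_powR_lt1.
set c := 2 * H * (2 * T) `^ gamma * q / (1 - q).
have [n] := geometric_small (c + H * (2 * T) `^ gamma) q01 e0.
rewrite mulrDl => small.
have [Fn _] := tree_point_spec T0 H0 reach hP Fw tT n.
have [a Fa na] := reach _ _ _ (cell_left_in n T0 tT) tT Fn.
exists a => //; apply: le_lt_trans small.
apply: (le_trans (enorm_le_trans (tree_point P n (cell T n t) w) _ _)).
apply: lerD; first exact: (tree_selection_approx T0 g0 H0 reach hP Fw tT n).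
apply: (le_trans na); rewrite -mulrA -powR_mesh// ler_wpM2l//.
have t0 : 0 <= t by move: tT; rewrite in_itv/= => /andP[].
have /andP[lo hi] := cell_itv n T0 t0.
rewrite ge0_ler_powR ?nnegrE ?(ltW g0) ?(ltW (mesh_gt0 _ T0))//.
rewrite ger0_norm ?subr_ge0//; move: hi; rewrite -natr1 mulrDl mul1r; lra.
Qed.

(** Two times in the same cell of rank [n] have branches that agree up to rank [n], so
    both limits are within the geometric tail of one common point. *)
Lemma tree_selection_oscillation (R : realType) d (T gamma H : R)
    (F : R -> set 'rV[R]_d) P w (q := 2 `^ (- gamma)) :
  0 < T -> 0 < gamma -> 0 <= H ->
  holder_reachable T gamma H F ->
  tree_projections T gamma H F P -> F 0 w ->
  cell_oscillation T (4 * H * (2 * T) `^ gamma * q / (1 - q)) q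
    (tree_selection T P w).
Proof.
move=> T0 g0 H0 reach hP Fw n s t sT tT st.
apply: (le_trans (enorm_le_trans (tree_point P n (cell T n t) w) _ _)).
have := tree_selection_approx T0 g0 H0 reach hP Fw tT n.
have := tree_selection_approx T0 g0 H0 reach hP Fw sT n.
rewrite -st enormB -/q; set X := enorm _; set Y := enorm _.
have -> : 4 * H * (2 * T) `^ gamma * q / (1 - q) * q ^+ n =
  2 * (2 * H * (2 * T) `^ gamma * q / (1 - q) * q ^+ n) by ring.
lra.
Qed.

Lemma measurable_path_map (R : realType) d (T : R) (D : set 'rV[R]_d)
    (f : 'rV[R]_d -> R -> 'rV[R]_d) :
  (forall t, t \in `[0, T] ->
    measurable_fun (D : set (borelRd R d))
      ((fun w => f w t) : borelRd R d -> borelRd R d)) ->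
  measurable_fun (D : set (borelRd R d)) (f : borelRd R d -> path_space d T).
Proof.
move=> mf mD; move: (mD).
apply: (@measurability _ _ (borelRd R d) (path_space d T) D f (@cylinders R d T)).
  by [].
by move=> _ [_ [t tT [B mB <-]] <-]; rewrite setTI; exact: mf.
Qed.

Theorem theoremI2p1 (R : realType) (T gamma : R)
    (hT : 0 < T) (hgamma0 : 0 < gamma) (hgamma1 : gamma <= 1) :
  exists C : R -> R,
  forall (d : nat) (hd : (1 <= d)%N) (F : R -> set 'rV[R]_d)
    (hF : forall t, t \in `[0, T] -> nonempty_compacts (F t))
    (hFgamma : (holder_coef T gamma F < +oo)%E),
  exists f : 'rV[R]_d -> R -> 'rV[R]_d,
    (forall omega, F 0 omega ->
       [/\ Vspace_plus T gamma^-1 (f omega),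
           forall t, t \in `[0, T] -> F t (f omega t),
           f omega 0 = omega
         & forall p : R, gamma^-1 < p ->
             (p_variation T p (f omega) <= (C p)%:E * holder_coef T gamma F)%E])
    /\ measurable_fun (F 0 : set (borelRd R d))
         (f : borelRd R d -> path_space d T).
Proof.
set q : R := 2 `^ (- gamma).
have q01 : 0 <= q < 1 by rewrite powR_ge0 half_powR_lt1.
have q0 : 0 < q by exact: powR_gt0.
pose C p := 4 * (2 * T) `^ gamma / (1 - q) * (1 - 2 * q `^ p)^-1 `^ p^-1.
exists C => d _ F FK Ffin.
have [H FH] : exists H, holder_coef T gamma F = H%:E.
  exists (fine (holder_coef T gamma F)).
  by rewrite fineK// ge0_fin_numE// holder_coef_ge0.
have H0 : 0 <= H by rewrite -lee_fin -FH holder_coef_ge0.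
have reach := holder_nearest hgamma0 FK FH.
have [P [hP mP]] := exists_tree_projections gamma H0 FK.
exists (tree_selection T P); split=> [w Fw|].
  have osc := tree_selection_oscillation hT hgamma0 H0 reach hP Fw.
  have bound p : gamma^-1 < p ->
      (p_variation T p (tree_selection T P w) <= (C p)%:E * holder_coef T gamma F)%E.
    move=> gp; have p0 : 0 < p by apply: lt_trans gp; rewrite invr_gt0.
    rewrite FH -EFinM.
    have -> : C p * H = 4 * H * (2 * T) `^ gamma * q / (1 - q) / q *
        (1 - 2 * q `^ p)^-1 `^ p^-1.
      by rewrite /C; field; rewrite subr_eq0 !gt_eqF//; case/andP: q01.
    apply: p_variation_cell_oscillation => //; last exact: variation_ratio_lt1.
    case/andP: q01 => _ q1.
    by rewrite divr_ge0 ?subr_ge0 ?(ltW q1)// !mulr_ge0 ?powR_ge0// ltW.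
  split=> // [p gp|t tT|]; first split.
  - exact: (cadlag_cell_oscillation hT q01 osc).
  - by apply: (le_lt_trans (bound p gp)); rewrite FH -EFinM ltry.
  - exact: (tree_selection_in hT hgamma0 H0 FK reach hP Fw tT).
  - rewrite /tree_selection; under eq_fun do rewrite cell_at0 tree_point0.
    exact: lim_cst.
apply: measurable_path_map => t tT.
apply: (measurable_uniform_limit (u := fun n => tree_point P n (cell T n t))
    (b := fun n => 2 * H * (2 * T) `^ gamma * q / (1 - q) * q ^+ n)).
- by move=> n; apply: measurable_funTS; exact: measurable_tree_point.
- by move=> n w Fw; exact: (tree_selection_approx hT hgamma0 H0 reach hP Fw tT n).
- by move=> e e0; exact: geometric_small.
Qed.
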